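(* Let $(\mathcal{X},\delta)$ be a metric-like space and let $\mathcal{I}$ be an admissible ideal of subsets of $\mathbb{N}$ satisfying the condition (AP). Let $\{x_n\}_{n\in\mathbb{N}}$ be a sequence in $\mathcal{X}$ and $x_o\in\mathcal{X}$. If $\{x_n\}_{n\in\mathbb{N}}$ is $\mathcal{I}$-convergent to $x_o$, then $\{x_n\}_{n\in\mathbb{N}}$ is $\mathcal{I}^{*}$-convergent to $x_o$.
   Context: A metric-like space is a pair $(\mathcal{X},\delta)$ where $\mathcal{X}$ is a non-empty set and $\delta:\mathcal{X}\times\mathcal{X}\to\mathbb{R}_{\ge 0}$ satisfies, for all $x,y,z\in\mathcal{X}$: (1) $\delta(x,y)=0\Rightarrow x=y$; (2) $\delta(x,y)=\delta(y,x)$; (3) $\delta(x,y)\le\delta(x,z)+\delta(z,y)$. The value $\delta(x,x)$ may be positive. An ideal in $\mathbb{N}$ is a non-empty class $\mathcal{I}$ of subsets of $\mathbb{N}$ containing $\emptyset$, closed under finite unions and under taking subsets. It is admissible if $\mathbb{N}\notin\mathcal{I}$, $\mathcal{I}\ne\{\emptyset\}$, and $\{z\}\in\mathcal{I}$ for every $z\in\mathbb{N}$. The associated filter is $\mathcal{F}(\mathcal{I})=\{\mathbb{N}\setminus A: A\in\mathcal{I}\}$. An admissible ideal $\mathcal{I}$ satisfies the condition (AP) if for every countable collection $\{A_j\}_{j\in\mathbb{N}}$ of mutually disjoint sets belonging to $\mathcal{I}$ there exists a countable family of sets $\{B_j\}_{j\in\mathbb{N}}$ (subsets of $\mathbb{N}$)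 such that the symmetric difference $A_j\Delta B_j$ is finite for each $j\in\mathbb{N}$ and $\bigcup_{j=1}^{\infty}B_j\in\mathcal{I}$. A sequence $\{x_n\}$ in $(\mathcal{X},\delta)$ is $\mathcal{I}$-convergent to $x_o\in\mathcal{X}$ if for every $\epsilon>0$ the set $\{n\in\mathbb{N}: |\delta(x_n,x_o)-\delta(x_o,x_o)|\ge\epsilon\}$ belongs to $\mathcal{I}$. It is $\mathcal{I}^{*}$-convergent to $x_o\in\mathcal{X}$ if there exists $M=\{n_1<n_2<\cdots\}\in\mathcal{F}(\mathcal{I})$ such that $\lim_{k\to\infty}\delta(x_{n_k},x_o)=\delta(x_o,x_o)$. *)

(* Defs.v *)
From mathcomp Require Import all_boot all_order all_algebra.
From mathcomp Require Import all_classical all_reals all_analysis.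
Import numFieldNormedType.Exports.
Set Implicit Arguments.
Unset Strict Implicit.
Unset Printing Implicit Defensive.
Import Order.TTheory GRing.Theory Num.Theory.
Local Open Scope classical_set_scope.
Local Open Scope ring_scope.

(* The self-distance delta x x may be positive. *)
Record metric_like (R : realType) (X : Type) (delta : X -> X -> R) : Prop := {
  ml_nonempty : inhabited X;
  ml_ge0 : forall x y, 0 <= delta x y;
  ml_eq : forall x y, delta x y = 0 -> x = y;
  ml_sym : forall x y, delta x y = delta y x;
  ml_triangle : forall x y z, delta x y <= delta x z + delta z y }.

(* The empty set and binary unions give all finite unions. *)
Record ideal (I : set (set nat)) : Prop := {
  ideal_set0 : I set0;
  ideal_setU : forall A B, I A -> I B -> I (A `|` B);
  ideal_sub : forall A B, A `<=` B -> I B -> I A }.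

Record admissible (I : set (set nat)) : Prop := {
  admissible_ideal : ideal I;
  admissible_setT : ~ I setT;
  admissible_neq0 : I <> [set set0];
  admissible_set1 : forall z : nat, I [set z] }.

Definition ideal_filter (I : set (set nat)) : set (set nat) :=
  [set ~` A | A in I].

Definition condition_AP (I : set (set nat)) : Prop :=
  forall A : nat -> set nat,
    (forall j, I (A j)) -> trivIset setT A ->
    exists B : nat -> set nat,
      (forall j, finite_set (A j `+` B j)) /\ I (\bigcup_j B j).

Definition ideal_cvg (R : realType) (X : Type) (delta : X -> X -> R)
    (I : set (set nat)) (x : nat -> X) (x0 : X) : Prop :=
  forall e : R, 0 < e ->
    I [set n | e <= `|delta (x n) x0 - delta x0 x0|].

(* M = {n_1 < n_2 < ...} is the range of its strictly increasing enumeration. *)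
Definition ideal_star_cvg (R : realType) (X : Type) (delta : X -> X -> R)
    (I : set (set nat)) (x : nat -> X) (x0 : X) : Prop :=
  exists n_ : nat -> nat,
    [/\ {homo n_ : k l / (k < l)%N},
        ideal_filter I (range n_) &
        delta (x (n_ k)) x0 @[k --> \oo] --> delta x0 x0].

(* Main.v *)
(** Condition (AP) makes [I] a P-ideal: applied to the disjointification of the
    sets [{n | 1/(k+1) <= |delta (x n) x0 - delta x0 x0|}], it yields one set
    [S] in [I] containing each of them up to a finite set. The complement of [S]
    is infinite, since admissible ideals contain the finite sets, and its
    increasing enumeration meets each of these sets only finitely often. *)

Require Import Defs.
From mathcomp Require Import all_boot all_order all_algebra.
From mathcomp Require Import all_classical all_reals all_analysis.

Import Order.TTheory GRing.Theory Num.Theory.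
Local Open Scope classical_set_scope.
Local Open Scope ring_scope.

Lemma finite_set_nat_ltn (A : set nat) :
  finite_set A -> exists N, forall n, A n -> (n < N)%N.
Proof.
move=> /finite_seqP[s ->]; exists (\max_(i <- s) i).+1 => n /= ns.
by rewrite ltnS; exact: leq_bigmax_seq.
Qed.

Lemma leq_homo_ltn (f : nat -> nat) :
  {homo f : k l / (k < l)%N} -> forall k, (k <= f k)%N.
Proof. by move=> f_homo; elim=> // k /leq_ltn_trans; apply; exact: f_homo. Qed.

Lemma infinite_set_nat_geq (A : set nat) :
  infinite_set A -> forall m, exists2 n, A n & (m <= n)%N.
Proof.
move=> Ainf m; apply: contrapT => /forall2NP noA; apply: Ainf.
apply: (sub_finite_set _ (finite_II m)) => n An /=.
by case: (noA n) => // /negP; rewrite -ltnNge.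
Qed.

(** The enumeration is greedy: [next m] is the least element of [A] that is at least [m], and each
    value of [n_] is [next] of the successor of the previous one. *)
Lemma infinite_set_nat_enum (A : set nat) : infinite_set A ->
  exists2 n_ : nat -> nat, {homo n_ : k l / (k < l)%N} & range n_ = A.
Proof.
move=> Ainf.
have /choice[next nextP] m : exists n,
    [/\ A n, (m <= n)%N & forall p, A p -> (m <= p)%N -> (n <= p)%N].
  have exA : exists n, `[< A n >] && (m <= n)%N.
    have [n An mn] := infinite_set_nat_geq _ Ainf m.
    by exists n; rewrite mn andbT; exact/asboolP.
  case: (ex_minnP exA) => n /andP[/asboolP An mn] nmin.
  by exists n; split => // p Ap mp; apply: nmin; rewrite mp andbT; exact/asboolP.
pose fix n_ k := next (if k is k'.+1 then (n_ k').+1 else 0%N).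
have n_homo : {homo n_ : k l / (k < l)%N}.
  by apply: homo_ltn => [? ? ?|k]; [exact: ltn_trans|case: (nextP (n_ k).+1)].
have n_A k : A (n_ k).
  by case: k => [|k] /=; [case: (nextP 0%N)|case: (nextP (n_ k).+1)].
exists n_ => //; apply/seteqP; split => [_ [k _ <-]//|m Am].
(* Since [m < n_ m.+1], bounding [m] by some value of [n_] costs nothing. By minimality of [next],
   no element of [A] lies below [n_ 0] or strictly between two successive values. *)
suff below k : (m < n_ k)%N -> range n_ m.
  by apply: (below m.+1); exact: leq_homo_ltn.
elim: k => [|k IHk] mlt.
  by have [_ _ /(_ m Am isT)] := nextP 0%N; rewrite leqNgt mlt.
have [/IHk//|ltm|->] := ltngtP m (n_ k); last by exists k.
by have [_ _ /(_ m Am ltm)] := nextP (n_ k).+1; rewrite leqNgt mlt.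
Qed.

Lemma admissible_finite_set (I : set (set nat)) (A : set nat) :
  admissible I -> finite_set A -> I A.
Proof.
move=> [[I0 IU Isub] _ _ I1] /finite_seqP[s ->]; elim: s => [|n s IHs].
  by rewrite set_nil.
apply: (Isub _ ([set n] `|` [set` s])); last exact: IU.
by move=> m /=; rewrite inE => /orP[/eqP|]; [left|right].
Qed.

Lemma ideal_bigsetU (I : set (set nat)) (U : nat -> set nat) (n : nat) :
  ideal I -> (forall j, I (U j)) -> I (\big[setU/set0]_(j < n) U j).
Proof. by move=> [I0 IU _] IUj; elim/big_ind : _. Qed.

(** (AP) only concerns disjoint families, so it is applied to [seqDU U], whose first [j.+1] terms
    still cover [U j]. *)
Lemma condition_AP_pseudo_union (I : set (set nat)) (U : nat -> set nat) :
  ideal I -> condition_AP I -> (forall j, I (U j)) ->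
  exists2 S, I S & forall j, finite_set (U j `\` S).
Proof.
move=> idI API IU.
have IA j : I (seqDU U j) by apply: ideal_sub (IU j) => //; exact: subset_seqDU.
have [B [finAB IB]] := API _ IA (trivIset_seqDU U).
exists (\bigcup_j B j) => // j.
(* A point of [U j] lies in [seqDU U i] for some [i <= j]; if it avoids every [B], it lies in the
   finite set [seqDU U i]+[B i]. *)
apply: (@sub_finite_set _ _ (\bigcup_(i in `I_j.+1) (seqDU U i `+` B i))).
  move=> n [Ujn nB].
  have : (\big[setU/set0]_(i < j.+1) U i) n by apply: (@bigsetU_sup _ j) Ujn.
  rewrite bigsetU_seqDU -bigcup_mkord => -[i ij An]; exists i => //.
  by left; split => // Bn; apply: nB; exists i.
by apply: bigcup_finite => //; exact: finite_II.
Qed.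

Theorem theorem4p4 (R : realType) (X : Type) (delta : X -> X -> R)
    (I : set (set nat)) (x : nat -> X) (x0 : X) :
  metric_like delta ->
  admissible I ->
  condition_AP I ->
  ideal_cvg delta I x x0 ->
  ideal_star_cvg delta I x x0.
Proof.
move=> _ admI API xI; have idI := admissible_ideal admI.
pose U k := [set n | k.+1%:R^-1 <= `|delta (x n) x0 - delta x0 x0|].
have IU k : I (U k) by apply: xI; rewrite invr_gt0 ltr0n.
have [S IS finUS] := condition_AP_pseudo_union _ _ idI API IU.
have infS : infinite_set (~` S).
  move=> finS; apply: (admissible_setT admI); rewrite -(setUv S).
  by apply: ideal_setU => //; exact: admissible_finite_set.
have [n_ n_homo rangen] := infinite_set_nat_enum _ infS.
exists n_; split => //; first by rewrite rangen; exists S.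
apply/cvgrPdist_lt => e e0.
(* [j] is chosen with [1/(j+1) < e], so a term at distance [e] or more would have its index in
   [U j]. *)
have [j _ /(_ j (leqnn j)) /= je] := near_infty_natSinv_lt (PosNum e0).
have [N ltN] := finite_set_nat_ltn _ (finUS j).
near=> k; rewrite distrC; apply: le_lt_trans je; rewrite leNgt.
apply/negP => /ltW Ujk.
(* The index [n_ k] avoids [S], so membership in [U j] would force [n_ k < N]; yet [N <= k <= n_ k]
   for large [k]. *)
have : (n_ k < N)%N.
  by apply: ltN; split => //; have : range n_ (n_ k) by []; rewrite rangen.
apply/negP; rewrite -leqNgt; apply: leq_trans (leq_homo_ltn _ n_homo k).
by near: k; exact: nbhs_infty_ge.
Unshelve. all: by end_near.
Qed.
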